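(* Consider a Bayesian persuasion problem $(\Omega, A, u_S, u_R, \mu)$ and a signaling scheme $\pi : \Omega \to \Delta^S$ with signal set $S$. If the sender utility satisfies $\mathsf{Range}(u_S) \subset [0,1]$, then for every round $k \ge 1$, $$BPR(\pi) - IR_k(\pi) \;\leq\; \sum_{s \in S} \sqrt{\frac{p^\pi(s)}{k}}\; \frac{\nu(y_s^\pi)}{d(y_s^\pi)} .$$
   Context: All sets $\Omega$ (states), $A$ (receiver actions), $S$ (signals) are finite; $\Delta^{X}$ is the set of probability distributions on $X$. $\mu\in\Delta^\Omega$ is the state distribution, $u_S,u_R:\Omega\times A\to\mathbb{R}$ are the sender and receiver utilities; $u_S(:,a),u_R(:,a)\in\mathbb{R}^\Omega$ are the utility vectors for action $a$. For a scheme $\pi$, $\pi(\omega,s)$ is the probability of signal $s$ in state $\omega$; $p^\pi(\omega,s)=\mu(\omega)\pi(\omega,s)$ is the joint law, $p^\pi(s)=\sum_\omega p^\pi(\omega,s)$ (assumed positive for every $s\in S$), and $y^\pi_s\in\Delta^\Omega$, $y^\pi_s(\omega)=p^\pi(\omega,s)/p^\pi(s)$, is the posterior. Receiver action: for $x\in\Delta^\Omega$, $a(x)$ is an element of $\arg\max_{a\in A}\langle u_R(:,a),x\rangle$, ties being broken in favor of an action maximizing $\langle u_S(:,a),x\rangle$ (remaining ties by a fixed selection). $E_a=\{y\in\Delta^\Omega : a(y)=a\}$, and $a^\pi(s)=a(y^\pi_s)$. Known-commitment value: $BPR(\pi)=\mathbb{E}_{\omega\sim\mu,\,s\sim\pi(\omega)}[u_S(\omega,a^\pi(s))]$.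 Inference setting at round $k\ge 1$: let $Z\sim\mathsf{Multi}(k-1,p^\pi)$ (multinomial counts on $\Omega\times S$) and, for each $s$, independently $Y_s\sim\mathsf{Multi}(1,y^\pi_s)$ (one initial sample from each posterior). Counts are $\#(\omega,s)_k=Z(\omega,s)+Y_s(\omega)$ and the receiver's posterior estimate is $\hat y^\pi_{s,k}(\omega)=\#(\omega,s)_k/\sum_{\omega'}\#(\omega',s)_k$. On seeing signal $s$ at round $k$ the receiver takes action $a(\hat y^\pi_{s,k})$. The sender's round-$k$ reward is $IR_k(\pi)=\mathbb{E}_{\omega\sim\mu,\,s\sim\pi(\omega)}\,\mathbb{E}[u_S(\omega,a(\hat y^\pi_{s,k}))]$, where the current pair $(\omega,s)$ is independent of the counts; equivalently $IR_k(\pi)=\sum_{s}p^\pi(s)\sum_{a}\langle u_S(:,a),y^\pi_s\rangle\,\mathbb{P}[\hat y^\pi_{s,k}\in E_a]$. For $x\in\Delta^\Omega$: the stochasticity is $\nu(x)=\big(\sum_{\omega}x(\omega)(1-x(\omega))\big)^{1/2}$. Let $C_{a,a'}=\{y\in\Delta^\Omega : \langle y,u_R(:,a)-u_R(:,a')\rangle=0\}$. For $x\in E_a$, $d(x)=\min_{a'\in A\setminus\{a\}}\min_{y\in C_{a,a'}}\|y-x\|_2$, where a minimum over the empty set is $+\infty$. The ratio $\nu/d$ is read as $+\infty$ if $d=0$ and as $0$ if $d=+\infty$. *)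

(* Defs.v *)
From mathcomp Require Import all_boot all_order all_algebra.
From mathcomp Require Import all_classical all_reals all_analysis.

Set Implicit Arguments.
Unset Strict Implicit.
Unset Printing Implicit Defensive.

Import Order.TTheory GRing.Theory Num.Theory.

Local Open Scope classical_set_scope.
Local Open Scope ring_scope.

Definition simplex (R : realType) (X : finType) : set {ffun X -> R} :=
  [set x : {ffun X -> R} | (forall i, 0 <= x i) /\ \sum_i x i = 1].
Arguments simplex {R X}.

Definition expect (R : realType) (X : finType) (p : {ffun X -> R})
  (f : X -> R) : R := \sum_x p x * f x.

Definition dotp (R : realType) (X : finType) (u v : X -> R) : R :=
  \sum_x u x * v x.

Definition dist2 (R : realType) (X : finType) (x y : {ffun X -> R}) : R :=
  Num.sqrt (\sum_i (x i - y i) ^+ 2).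

(* Probability mass function of Multi(n, p).  No count can exceed [n], so the
   count vectors are taken in the finite type {ffun X -> 'I_n.+1}. *)
Definition multi_pmf (R : realType) (X : finType) (n : nat)
  (p : {ffun X -> R}) :
  {ffun {ffun X -> 'I_n.+1} -> R} :=
  [ffun z : {ffun X -> 'I_n.+1} =>
    if (\sum_i (z i : nat) == n)%N
    then n`!%:R / (\prod_i ((z i)`!)%:R) * \prod_i p i ^+ z i
    else 0].

Section Persuasion.
Context (R : realType) (Omega A S : finType).
Implicit Types (u uS uR : Omega -> A -> R) (mu x y : {ffun Omega -> R})
  (pi : Omega -> {ffun S -> R}) (act : {ffun Omega -> R} -> A) (s : S).

Definition argmax_utility u x : set A :=
  [set a | forall b, dotp (u^~ b) x <= dotp (u^~ a) x].

(* [act] is a receiver action function x |-> a(x); ties left after favouring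
   the sender are resolved by [act] itself. *)
Definition receiver_action uS uR act : Prop :=
  forall x, simplex x ->
    argmax_utility uR x (act x) /\
    forall b, argmax_utility uR x b ->
      dotp (uS^~ b) x <= dotp (uS^~ (act x)) x.

Definition joint mu pi : {ffun Omega * S -> R} :=
  [ffun ws : Omega * S => mu ws.1 * pi ws.1 ws.2].

Definition marg mu pi s : R := \sum_w joint mu pi (w, s).

Definition posterior mu pi s : {ffun Omega -> R} :=
  [ffun w => joint mu pi (w, s) / marg mu pi s].

Definition BPR uS mu pi act : R :=
  expect mu (fun w => expect (pi w) (fun s =>
    uS w (act (posterior mu pi s)))).

(* Outcomes at round k: the multinomial counts Z and, for each signal, the
   one-sample counts Y_s.  The law of (Z, Y) is the product law. *)
Definition outcome (k : nat) : finType :=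
  ({ffun Omega * S -> 'I_k.-1.+1} * {ffun S -> {ffun Omega -> 'I_2}})%type.

Definition outcome_law mu pi (k : nat) : {ffun outcome k -> R} :=
  [ffun c : outcome k =>
    multi_pmf k.-1 (joint mu pi) c.1 *
    \prod_s multi_pmf 1 (posterior mu pi s) (c.2 s)].

Definition sample_count (k : nat) (c : outcome k) (w : Omega) s : nat :=
  (c.1 (w, s) + c.2 s w)%N.

Definition estimate (k : nat) (c : outcome k) s : {ffun Omega -> R} :=
  [ffun w => (sample_count c w s)%:R / (\sum_w' sample_count c w' s)%N%:R].

Definition IR uS mu pi act (k : nat) : R :=
  expect mu (fun w => expect (pi w) (fun s =>
    expect (outcome_law mu pi k) (fun c => uS w (act (estimate c s))))).

Definition stochasticity x : R := Num.sqrt (\sum_w x w * (1 - x w)).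

Definition indiff uR (a a' : A) : set {ffun Omega -> R} :=
  [set y | simplex y /\ dotp y (fun w => uR w a - uR w a') = 0].

(* The inner minimum is over a compact set, so it is the infimum; both minima
   are +oo over the empty set. *)
Definition boundary_dist uR act x : \bar R :=
  \big[Order.min/+oo%E]_(a' | a' != act x)
    ereal_inf [set (dist2 y x)%:E | y in indiff uR (act x) a'].

(* Differs from the library's [/] on \bar R: here n / 0 is +oo also when n = 0. *)
Definition nu_over_d (n : R) (d : \bar R) : \bar R :=
  if d == 0%E then +oo%E else if d == +oo%E then 0%E else (n / fine d)%:E.

End Persuasion.

Arguments estimate {R Omega S k} c s.
Arguments nu_over_d {R} n d.

(* Main.v *)
(** For each signal s the loss is at most p(s) times the probability that the
    estimated posterior triggers another action than the true one. In that case
    the segment joining the two posteriors meets an indifference set, so the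
    estimation error is at least d. Chebyshev bounds this probability by the
    mean squared error over d^2. Given the number N of samples with signal s,
    the mean squared error is nu^2 / N; and E[1/N] <= 1 / (k p(s)) because N - 1
    is binomial with parameters k - 1 and p(s). So the probability is at most
    r^2 with r = nu / (d sqrt (k p(s))), hence, being at most 1, at most r. *)
Require Import Defs.
From mathcomp Require Import all_boot all_order all_algebra.
From mathcomp Require Import all_classical all_reals all_analysis.
From mathcomp Require Import ring lra zify.

Import Order.TTheory GRing.Theory Num.Theory.
Local Open Scope ring_scope.

(** * Multinomial expectations and their recursion in the number of draws *)

Section Multinomial.
Context {R : realType} {X : finType}.
Implicit Types (p : {ffun X -> R}) (F G : {ffun X -> nat} -> R).

(** Integrands read counts in [nat], so that one [F] serves for every [n], although the type of the
    count vectors depends on [n]. *)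
Definition multi_exp (n : nat) p F : R :=
  \sum_(z : {ffun X -> 'I_n.+1}) multi_pmf n p z * F [ffun x => z x : nat].

Definition incr (x : X) (z : {ffun X -> nat}) : {ffun X -> nat} :=
  [ffun y => z y + (y == x)]%N.

Lemma multi_pmfE n p (z : {ffun X -> 'I_n.+1}) :
  multi_pmf n p z =
  if (\sum_i (z i : nat) == n)%N
  then n`!%:R / (\prod_i ((z i)`!)%:R) * \prod_i p i ^+ z i else 0.
Proof. by rewrite ffunE. Qed.

Lemma multi_pmf_ge0 n p (z : {ffun X -> 'I_n.+1}) :
  (forall x, 0 <= p x) -> 0 <= multi_pmf n p z.
Proof.
move=> p_ge0; rewrite multi_pmfE; case: ifP => // _.
apply: mulr_ge0; last by apply: prodr_ge0 => i _; exact: exprn_ge0.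
by apply: divr_ge0 => //; apply: prodr_ge0.
Qed.

Lemma eq_multi_exp n p F G : F =1 G -> multi_exp n p F = multi_exp n p G.
Proof. by move=> FG; apply: eq_bigr => z _; rewrite FG. Qed.

Lemma multi_expZ n p (c : R) F :
  multi_exp n p (fun z => c * F z) = c * multi_exp n p F.
Proof. by rewrite /multi_exp mulr_sumr; apply: eq_bigr => z _; rewrite mulrCA. Qed.

Lemma multi_exp_sum n p (I : Type) (r : seq I) (P : pred I)
    (H : I -> {ffun X -> nat} -> R) :
  multi_exp n p (fun z => \sum_(i <- r | P i) H i z) =
  \sum_(i <- r | P i) multi_exp n p (H i).
Proof.
by rewrite /multi_exp exchange_big; apply: eq_bigr => z _; rewrite mulr_sumr.
Qed.

Lemma le_multi_exp n p F G : (forall x, 0 <= p x) ->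
  (forall z, F z <= G z) -> multi_exp n p F <= multi_exp n p G.
Proof.
by move=> p_ge0 FG; apply: ler_sum => z _; apply: ler_wpM2l; rewrite ?multi_pmf_ge0.
Qed.

(** Only vectors with [z x > 0] contribute. Removing one from [z x] maps those of total [n.+1]
    bijectively onto the vectors of total [n], and each weight is [n.+1 * p x / z x] times that of
    its image. *)
Lemma multi_exp_sizebias n p x F :
  multi_exp n.+1 p (fun z => (z x)%:R * F z) =
  n.+1%:R * p x * multi_exp n p (fun z => F (incr x z)).
Proof.
pose P (z : {ffun X -> 'I_n.+2}) := (0 < z x)%N && (\sum_i (z i : nat) == n.+1)%N.
(* [inord] never takes its default value in [h], since [z y <= n]. In [h'] it does not on [P]: one
   of the [n.+1] samples is at [x], which leaves at most [n] for any other entry. *)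
pose h (z : {ffun X -> 'I_n.+1}) : {ffun X -> 'I_n.+2} :=
  [ffun y => inord (z y + (y == x))].
pose h' (z : {ffun X -> 'I_n.+2}) : {ffun X -> 'I_n.+1} :=
  [ffun y => inord (z y - (y == x))].
have hE z y : h z y = (z y + (y == x))%N :> nat.
  by rewrite ffunE inordK //; case: (y == x); have := ltn_ord (z y); lia.
have hK z : h' (h z) = z.
  apply/ffunP => y; rewrite ffunE; apply: val_inj.
  by rewrite /= hE addnK inordK.
have h'K z : P z -> h (h' z) = z.
  case/andP => zx_gt0 /eqP sz; apply/ffunP => y; apply: val_inj; rewrite /= hE.
  rewrite ffunE inordK.
    by have [->|_] := eqVneq y x; rewrite ?subnK ?subn0 ?addn0.
  have [->|yx] := eqVneq y x; first by have := ltn_ord (z x); lia.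
  have : (z y + z x <= n.+1)%N.
    apply: (leq_trans _ (eq_leq sz)).
    by rewrite (bigD1 y) //= (bigD1 x) 1?eq_sym //= addnA leq_addr.
  lia.
have sumh z : (\sum_i (h z i : nat) = (\sum_i (z i : nat)).+1)%N.
  under eq_bigr do rewrite hE.
  rewrite big_split /= -[RHS]addn1; congr addn.
  by rewrite (bigD1 x) //= eqxx big1 // => i /negPf ->.
rewrite /multi_exp (bigID P) /= [X in _ + X]big1 => [|z]; last first.
  rewrite negb_and -leqNgt leqn0 => /orP[/eqP z0|/negPf zn].
    by rewrite !ffunE z0 mul0r mulr0.
  by rewrite multi_pmfE zn mul0r.
rewrite addr0 (reindex_onto h h') //= mulr_sumr.
under eq_bigl => z do rewrite hK eqxx andbT /P sumh hE eqxx addn1 /= eqSS.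
rewrite big_mkcond /=; apply: eq_bigr => z _.
case: ifPn => [/eqP sz|zn]; last first.
  by rewrite multi_pmfE (negPf zn) mul0r mulr0.
rewrite !multi_pmfE sz eqxx sumh sz eqxx [X in X%:R * F _]ffunE hE eqxx addn1.
have -> : [ffun y => h z y : nat] = incr x [ffun y => z y : nat].
  by apply/ffunP => y; rewrite [LHS]ffunE hE !ffunE.
have fact_neq0 (m : nat) : (m`!)%:R != 0 :> R by rewrite pnatr_eq0 -lt0n fact_gt0.
have -> : \prod_i ((h z i)`!)%:R = (z x).+1%:R * \prod_i ((z i)`!)%:R :> R.
  rewrite (bigD1 x) //= [in RHS](bigD1 x) //= hE eqxx addn1 factS natrM -mulrA.
  congr (_ * (_ * _)); apply: eq_bigr => i /negPf ix; by rewrite hE ix addn0.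
have -> : \prod_i p i ^+ h z i = p x * \prod_i p i ^+ z i.
  rewrite (bigD1 x) //= [in RHS](bigD1 x) //= hE eqxx addn1 exprS -mulrA.
  congr (_ * (_ * _)); apply: eq_bigr => i /negPf ix; by rewrite hE ix addn0.
have prod_neq0 : \prod_i ((z i)`!)%:R != 0 :> R by apply/prodf_neq0.
have zx_neq0 : (z x).+1%:R != 0 :> R by rewrite pnatr_eq0.
rewrite factS natrM; field.
by rewrite prod_neq0 nat1r.
Qed.

Lemma multi_exp0 p F : multi_exp 0 p F = F [ffun=> 0%N].
Proof.
rewrite /multi_exp (bigD1 [ffun=> ord0]) //= big1 ?addr0 => [|z /eqP[]]; last first.
  by apply/ffunP => x; rewrite ffunE; apply: ord1.
rewrite multi_pmfE big1 ?eqxx => [|x _]; last by rewrite ffunE.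
rewrite !big1 => [|x _|x _]; rewrite ?ffunE ?expr0 // divr1 !mul1r.
by congr F; apply/ffunP => x; rewrite !ffunE.
Qed.

(** Counts of total [n.+1] satisfy [n.+1 * F z = \sum_x z x * F z]; size-biasing each term and
    cancelling [n.+1] isolates one draw. This is what drives the inductions on [n]. *)
Lemma multi_expS n p F :
  multi_exp n.+1 p F = \sum_x p x * multi_exp n p (fun z => F (incr x z)).
Proof.
have n_neq0 : n.+1%:R != 0 :> R by rewrite pnatr_eq0.
apply: (mulfI n_neq0); rewrite [RHS]mulr_sumr.
transitivity (\sum_x multi_exp n.+1 p (fun z => (z x)%:R * F z)); last first.
  by apply: eq_bigr => x _; rewrite multi_exp_sizebias mulrA.
rewrite -multi_exp_sum -multi_expZ /multi_exp; apply: eq_bigr => z _.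
rewrite multi_pmfE; case: ifP => [/eqP sz|_]; last by rewrite !mul0r.
rewrite -mulr_suml -natr_sum; congr (_ * (_%:R * _)); rewrite -[LHS]sz.
by apply: eq_bigr => x _; rewrite ffunE.
Qed.

Lemma multi_exp1 p F :
  multi_exp 1 p F = \sum_x p x * F (incr x [ffun=> 0%N]).
Proof. by rewrite multi_expS; under eq_bigr do rewrite multi_exp0. Qed.

Lemma multi_exp_cst n p (c : R) : \sum_x p x = 1 -> multi_exp n p (fun=> c) = c.
Proof.
move=> p1; elim: n => [|n IHn]; first by rewrite multi_exp0.
by rewrite multi_expS IHn -mulr_suml p1 mul1r.
Qed.

Lemma multi_pmf_sum1 n p : \sum_x p x = 1 -> \sum_z multi_pmf n p z = 1.
Proof.
move=> p1; rewrite -[RHS](multi_exp_cst n p 1 p1).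
by apply: eq_bigr => z _; rewrite mulr1.
Qed.

End Multinomial.

(** * Samples carrying one signal [s], of probability [m] and posterior [y] *)

Section Sampling.
Context {R : realType} {Omega S : finType}.
Variables (q : {ffun Omega * S -> R}) (s : S) (m : R) (y : {ffun Omega -> R}).
Hypothesis q_cond : forall w, q (w, s) = m * y w.
Hypothesis q_sum1 : \sum_x q x = 1.
Hypothesis y_sum1 : \sum_w y w = 1.

Definition nsig (z : {ffun Omega * S -> nat}) : nat := (\sum_w z (w, s))%N.

Lemma nsig_incr w t z : nsig (incr (w, t) z) = (nsig z + (t == s))%N.
Proof.
rewrite /nsig; under eq_bigr do rewrite ffunE.
rewrite big_split /=; congr addn; rewrite (bigD1 w) //= xpair_eqE eqxx /= eq_sym.
by rewrite big1 ?addn0 // => i /negPf iw; rewrite xpair_eqE iw.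
Qed.

Lemma sum_on_signal (H : Omega * S -> R) :
  \sum_(x | x.2 == s) q x * H x = m * \sum_w y w * H (w, s).
Proof.
rewrite (reindex_onto (fun w => (w, s)) fst) /= => [|[w t] /= /eqP -> //].
rewrite mulr_sumr; apply: eq_big => [w|w _]; first by rewrite !eqxx.
by rewrite q_cond mulrA.
Qed.

(** Meant for [multi_expS]: a draw with another signal leaves the counts of [s] unchanged, so such
    draws share one value and only their total mass [1 - m] matters. *)
Lemma sum_off_signal (H : Omega * S -> R) (c : R) :
  (forall w t, t != s -> H (w, t) = c) ->
  \sum_x q x * H x = m * \sum_w y w * H (w, s) + (1 - m) * c.
Proof.
move=> Hc; rewrite (bigID (fun x => x.2 == s)) /= sum_on_signal; congr (_ + _).
have -> : 1 - m = \sum_(x | x.2 != s) q x.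
  rewrite -q_sum1 (bigID (fun x => x.2 == s)) /=.
  have -> : \sum_(x | x.2 == s) q x = m.
    rewrite -[RHS]mulr1 -y_sum1.
    under [in RHS]eq_bigr do rewrite -[y _]mulr1.
    by rewrite -(sum_on_signal (fun=> 1)); apply: eq_bigr => x _; rewrite mulr1.
  by rewrite addrAC subrr add0r.
by rewrite mulr_suml; apply: eq_bigr => -[w t] /= ts; rewrite Hc.
Qed.

(** Under [y], the indicator of [w] has mean [y w] and variance [y w * (1 - y w)], so the squared
    term is that of a variable of mean [d] with this variance. *)
Lemma onehot_variance w d :
  \sum_w' y w' * (d + (w' == w)%:R - y w) ^+ 2 = d ^+ 2 + y w * (1 - y w).
Proof.
pose e w' : R := y w' * (d - y w) ^+ 2 + (if w' == w then y w * (2 * (d - y w) + 1) else 0).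
transitivity (\sum_w' e w').
  by apply: eq_bigr => w' _; rewrite /e; case: eqVneq => [->|_] /=; ring.
by rewrite /e big_split /= -mulr_suml y_sum1 -big_mkcond big_pred1_eq; ring.
Qed.

(* The increments of z (w, s) - y w * nsig z are centred given the past, and
   uncorrelated with the past even after weighting by a function of nsig. *)
Lemma multi_exp_deviation n w (d : R) (a : nat) (g : nat -> R) :
  multi_exp n q (fun z =>
    (d + (z (w, s))%:R - y w * (nsig z)%:R) ^+ 2 * g (a + nsig z)%N) =
  multi_exp n q (fun z =>
    (d ^+ 2 + y w * (1 - y w) * (nsig z)%:R) * g (a + nsig z)%N).
Proof.
elim: n d a => [|n IHn] d a.
  by rewrite !multi_exp0 /nsig ffunE big1 => [|w' _]; rewrite ?ffunE //; congr (_ * _); ring.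
have off (F : R -> nat -> R) w' t z : t != s ->
    F (incr (w', t) z (w, s))%:R (nsig (incr (w', t) z)) = F (z (w, s))%:R (nsig z).
  move=> /negPf ts; rewrite nsig_incr ts addn0 ffunE xpair_eqE [s == t]eq_sym ts andbF.
  by rewrite addn0.
rewrite !multi_expS.
rewrite (sum_off_signal _ (multi_exp n q (fun z =>
    (d + (z (w, s))%:R - y w * (nsig z)%:R) ^+ 2 * g (a + nsig z)%N))); last first.
  move=> w' t ts; apply: eq_multi_exp => z.
  by rewrite (off (fun u v => (d + u - y w * v%:R) ^+ 2 * g (a + v)%N)).
rewrite (sum_off_signal _ (multi_exp n q (fun z =>
    (d ^+ 2 + y w * (1 - y w) * (nsig z)%:R) * g (a + nsig z)%N))); last first.
  move=> w' t ts; apply: eq_multi_exp => z.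
  by rewrite (off (fun u v => (d ^+ 2 + y w * (1 - y w) * v%:R) * g (a + v)%N)).
rewrite IHn; congr (_ * _ + _).
(* A draw [(w', s)] moves [d] by [[w' = w] - y w] and [a] by one. The induction hypothesis is used
   at these new values, hence the generalization over both. *)
transitivity (\sum_w' multi_exp n q (fun z => y w' *
    (((d + (w' == w)%:R - y w) ^+ 2 + y w * (1 - y w) * (nsig z)%:R) *
      g (a.+1 + nsig z)%N))).
  apply: eq_bigr => w' _; rewrite multi_expZ -IHn; congr (_ * _).
  apply: eq_multi_exp => z.
  rewrite nsig_incr eqxx ffunE xpair_eqE eqxx andbT addnA addnAC (addn1 a) [w == w']eq_sym.
  by rewrite !natrD /=; congr (_ ^+ 2 * _); ring.
(* Averaging over [w'] contributes one more variance, which turns [nsig z] into [nsig z + 1]. *)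
transitivity (\sum_w' multi_exp n q (fun z => y w' *
    ((d ^+ 2 + y w * (1 - y w) * (nsig z + 1)%:R) * g (a.+1 + nsig z)%N))).
  rewrite -[LHS]multi_exp_sum -[RHS]multi_exp_sum; apply: eq_multi_exp => z.
  under eq_bigr do rewrite mulrA mulrDr.
  rewrite -mulr_suml big_split /= onehot_variance -mulr_suml y_sum1.
  by rewrite -mulr_suml y_sum1 !mul1r natrD; congr (_ * _); ring.
apply: eq_bigr => w' _; rewrite multi_expZ; congr (_ * _); apply: eq_multi_exp => z.
by rewrite nsig_incr eqxx addnA addnAC (addn1 a).
Qed.

(** Size-biasing in reverse, summed over the states: the left side is the mean of
    [nsig z * (nsig z)^-1] over [n.+1] draws, that is, the probability that [s] occurs at all. *)
Lemma multi_exp_inv_nsig n : (forall x, 0 <= q x) ->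
  n.+1%:R * m * multi_exp n q (fun z => (nsig z).+1%:R^-1) <= 1.
Proof.
move=> q_ge0.
have -> : n.+1%:R * m * multi_exp n q (fun z => (nsig z).+1%:R^-1) =
    multi_exp n.+1 q (fun z => (nsig z)%:R * (nsig z)%:R^-1).
  transitivity (\sum_w multi_exp n.+1 q (fun z => (z (w, s))%:R * (nsig z)%:R^-1)).
    under [RHS]eq_bigr => w _.
      rewrite (multi_exp_sizebias n q (w, s) (fun z => (nsig z)%:R^-1)) q_cond.
      rewrite (eq_multi_exp n q _ (fun z => (nsig z).+1%:R^-1)); last first.
        by move=> z; rewrite nsig_incr eqxx addn1.
      over.
    by rewrite -mulr_suml -mulr_sumr -mulr_sumr y_sum1 mulr1.
  rewrite -multi_exp_sum; apply: eq_multi_exp => z.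
  by rewrite -mulr_suml -natr_sum.
rewrite -[X in _ <= X](multi_exp_cst n.+1 q 1 q_sum1); apply: le_multi_exp => // z.
(* The product is 0 when [nsig z = 0], and 1 otherwise. *)
by case: (nsig z) => [|i]; rewrite ?mul0r ?ler01 // divff // pnatr_eq0.
Qed.

(** The initial sample [v] makes the total [1 + nsig z], so no division by zero occurs. The
    computation is exact up to the mean of [1 / (1 + nsig z)], which alone is estimated. *)
Lemma multi_exp_mse n : (forall x, 0 <= q x) -> 0 < m ->
  (forall w, 0 <= y w <= 1) ->
  multi_exp n q (fun z => multi_exp 1 y (fun v =>
    \sum_w ((z (w, s) + v w)%:R / (\sum_w' (z (w', s) + v w'))%N%:R - y w) ^+ 2))
  <= stochasticity y ^+ 2 / (n.+1%:R * m).
Proof.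
move=> q_ge0 m_gt0 y01.
have var_ge0 w : 0 <= y w * (1 - y w).
  by have /andP[y0 y1] := y01 w; rewrite mulr_ge0 // subr_ge0.
rewrite sqr_sqrtr ?sumr_ge0 //.
pose g (j : nat) : R := j%:R ^- 2.
rewrite [leLHS](_ : _ = (\sum_w y w * (1 - y w)) *
    multi_exp n q (fun z => (nsig z).+1%:R^-1)); last first.
  (* Given the initial state [w0], this has the shape of [multi_exp_deviation] with [d = [w0 = w] -
     y w] and [a = 1]. *)
  transitivity (\sum_w0 y w0 * \sum_w multi_exp n q (fun z =>
    ((w0 == w)%:R - y w + (z (w, s))%:R - y w * (nsig z)%:R) ^+ 2 * g (1 + nsig z)%N)).
    under [RHS]eq_bigr => w0 _ do rewrite -multi_exp_sum -multi_expZ.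
    rewrite -[RHS]multi_exp_sum; apply: eq_multi_exp => z; rewrite multi_exp1.
    apply: eq_bigr => w0 _; congr (_ * _); apply: eq_bigr => w _.
    have -> : (\sum_w' (z (w', s) + incr w0 [ffun=> 0] w') = 1 + nsig z)%N.
      rewrite big_split /= addnC /nsig; congr addn.
      by rewrite (bigD1 w0) //= big1 => [|i /negPf iw]; rewrite !ffunE ?iw ?eqxx.
    have N_neq0 : (1 + nsig z)%:R != 0 :> R by rewrite pnatr_eq0.
    rewrite !ffunE add0n [w == w0]eq_sym /g.
    by move: N_neq0; rewrite !natrD => ?; field.
  under eq_bigr => w0 _ do under eq_bigr => w _ do rewrite multi_exp_deviation.
  under eq_bigr => w0 _ do rewrite -multi_exp_sum -multi_expZ.
  rewrite -[LHS]multi_exp_sum -multi_expZ; apply: eq_multi_exp => z.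
  under eq_bigr do rewrite mulr_sumr.
  rewrite exchange_big mulr_suml; apply: eq_bigr => w _ /=.
  under eq_bigr do rewrite mulrA mulrDr.
  rewrite -mulr_suml big_split /= -mulr_suml y_sum1 mul1r.
  (* The mean of [d ^+ 2] over [w0] is one more variance: [1 + nsig z] of them over the squared
     total leave [1 / (1 + nsig z)]. *)
  have := onehot_variance w 0; rewrite expr0n /= add0r.
  under eq_bigr do rewrite add0r; move=> ->.
  have N_neq0 : (1 + nsig z)%:R != 0 :> R by rewrite pnatr_eq0.
  by rewrite /g -add1n; move: N_neq0; rewrite natrD => ?; field.
rewrite ler_pdivlMr ?mulr_gt0 ?ltr0n // -mulrA [X in _ * X]mulrC -[leRHS]mulr1.
by rewrite ler_wpM2l ?sumr_ge0 ?multi_exp_inv_nsig.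
Qed.

End Sampling.

Lemma simplex_le1 {R : realType} {X : finType} (x : {ffun X -> R}) i :
  simplex x -> 0 <= x i <= 1.
Proof.
case=> x_ge0 x1; rewrite x_ge0 -x1 (bigD1 i) //= lerDl.
by apply: sumr_ge0.
Qed.

(** * Distance from a posterior to the indifference sets *)

Section Geometry.
Context {R : realType} {Omega A : finType}.
Variables (uS uR : Omega -> A -> R) (act : {ffun Omega -> R} -> A).
Hypothesis act_receiver : receiver_action uS uR act.

Lemma boundary_dist_ge0 (x : {ffun Omega -> R}) : (0%E <= boundary_dist uR act x)%E.
Proof.
apply: le_bigmin => [|a _]; first by rewrite leey.
by apply: le_ereal_inf_tmp => _ [y _ <-]; rewrite lee_fin sqrtr_ge0.
Qed.

(* On the segment from x to e the preference between the two actions changes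
   sign, so the segment meets their indifference set. *)
Lemma boundary_dist_le (x e : {ffun Omega -> R}) :
  simplex x -> simplex e -> act e != act x ->
  (boundary_dist uR act x <= (dist2 e x)%:E)%E.
Proof.
move=> xS eS ne.
pose D w := uR w (act x) - uR w (act e).
have dotB (v : {ffun Omega -> R}) :
    dotp v D = dotp (uR^~ (act x)) v - dotp (uR^~ (act e)) v.
  by rewrite /dotp -sumrB; apply: eq_bigr => w _; rewrite /D; ring.
have al_ge0 : 0 <= dotp x D by rewrite dotB subr_ge0; apply: (act_receiver x xS).1.
have be_le0 : dotp e D <= 0 by rewrite dotB subr_le0; apply: (act_receiver e eS).1.
set al := dotp x D in al_ge0; set be := dotp e D in be_le0.
(* The affine function [al + t * (be - al)] is the value of [D] at [x + t * (e - x)]. The case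
   [al = 0] is separate because [al - be] may then vanish. *)
have [t [/andP[t0 t1] ht]] : exists t : R, 0 <= t <= 1 /\ al + t * (be - al) = 0.
  have [al0|al_neq0] := eqVneq al 0; first by exists 0; rewrite lexx ler01 al0 mul0r addr0.
  have al_gt0 : 0 < al by rewrite lt_neqAle eq_sym al_neq0.
  have ab_gt0 : 0 < al - be by lra.
  exists (al / (al - be)); rewrite (divr_ge0 al_ge0 (ltW ab_gt0)) /=.
  rewrite ler_pdivrMr // mul1r; split; first by lra.
  by field; rewrite gt_eqF.
pose y : {ffun Omega -> R} := [ffun w => x w + t * (e w - x w)].
apply: (@le_trans _ _ (dist2 y x)%:E).
  apply: (le_trans (@bigmin_le_cond _ _ _ _ _ (fun b => b != act x) _ ne)); apply: ereal_inf_lbound.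
  exists y => //; split.
    split=> [w|]; last first.
      under eq_bigr do rewrite ffunE.
      by rewrite big_split /= -mulr_sumr sumrB xS.2 eS.2 subrr mulr0 addr0.
    rewrite ffunE (_ : _ + _ = (1 - t) * x w + t * e w); last by ring.
    by rewrite addr_ge0 ?mulr_ge0 ?subr_ge0 ?xS.1 ?eS.1.
  rewrite -ht /al /be /dotp -sumrB mulr_sumr -big_split /=.
  by apply: eq_bigr => w _; rewrite ffunE /D; ring.
rewrite lee_fin /dist2 ler_wsqrtr //; apply: ler_sum => w _; rewrite ffunE.
rewrite addrAC subrr add0r exprMn ler_piMl ?sqr_ge0 // expr2.
by rewrite mulr_ile1.
Qed.

End Geometry.

(** * The law of the counts at round [k] and the error of the estimate *)

Section Outcome.
Context {R : realType} {Omega S : finType}.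
Variables (mu : {ffun Omega -> R}) (pi : Omega -> {ffun S -> R}).
Hypothesis mu_dist : simplex mu.
Hypothesis pi_dist : forall w, simplex (pi w).
Hypothesis marg_gt0 : forall s, 0 < marg mu pi s.

Lemma simplex_joint : simplex (joint mu pi).
Proof.
split=> [[w s]|]; first by rewrite ffunE mulr_ge0 ?mu_dist.1 ?(pi_dist w).1.
under eq_bigr do rewrite ffunE.
rewrite -(pair_bigA _ (fun w s => mu w * pi w s)) /= -[RHS]mu_dist.2.
by apply: eq_bigr => w _; rewrite -mulr_sumr (pi_dist w).2 mulr1.
Qed.

Lemma joint_posterior w s : joint mu pi (w, s) = marg mu pi s * posterior mu pi s w.
Proof. by rewrite [posterior _ _ _ _]ffunE mulrC divfK // gt_eqF. Qed.

Lemma simplex_posterior s : simplex (posterior mu pi s).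
Proof.
split=> [w|].
  by rewrite [posterior _ _ _ _]ffunE divr_ge0 ?simplex_joint.1 // ltW.
under eq_bigr do rewrite [posterior _ _ _ _]ffunE.
by rewrite -mulr_suml -/(marg mu pi s) divff // gt_eqF.
Qed.

Variable k : nat.

Lemma outcome_law_ge0 (c : outcome Omega S k) : 0 <= outcome_law mu pi k c.
Proof.
rewrite ffunE mulr_ge0 //; first by apply: multi_pmf_ge0 => x; apply: simplex_joint.1.
by apply: prodr_ge0 => s _; apply: multi_pmf_ge0 => x; apply: (simplex_posterior s).1.
Qed.

(** By independence, the initial samples of the signals other than [s] integrate to 1. *)
Lemma expect_outcome_law s (F : {ffun Omega * S -> nat} -> {ffun Omega -> nat} -> R) :
  expect (outcome_law mu pi k) (fun c =>
    F [ffun x => c.1 x : nat] [ffun w => c.2 s w : nat]) =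
  multi_exp k.-1 (joint mu pi) (fun z => multi_exp 1 (posterior mu pi s) (F z)).
Proof.
rewrite /expect; under eq_bigr do rewrite [outcome_law _ _ _ _]ffunE.
rewrite -(pair_bigA _ (fun (z : {ffun Omega * S -> 'I_k.-1.+1})
    (v : {ffun S -> {ffun Omega -> 'I_2}}) => multi_pmf k.-1 (joint mu pi) z *
  (\prod_t multi_pmf 1 (posterior mu pi t) (v t)) *
  F [ffun x => z x : nat] [ffun w => v s w : nat])) /=.
apply: eq_bigr => z _; under eq_bigr do rewrite -mulrA.
rewrite -mulr_sumr; congr (_ * _).
set Fz := F _.
(* Attaching the integrand to the factor [t = s] makes the summand a product over signals, so that
   sum and product can be exchanged. *)
pose G t (v : {ffun Omega -> 'I_2}) : R :=
  multi_pmf 1 (posterior mu pi t) v * (if t == s then Fz [ffun w => v w : nat] else 1).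
transitivity (\sum_(v : {ffun S -> {ffun Omega -> 'I_2}}) \prod_t G t (v t)).
  apply: eq_bigr => v _; rewrite big_split /=; congr (_ * _).
  by rewrite -big_mkcond big_pred1_eq.
rewrite -(bigA_distr_bigA G) (bigD1 s) //= [X in _ * X]big1 => [|t /negPf ts].
  by rewrite mulr1; apply: eq_bigr => v _; rewrite /G eqxx.
under eq_bigr do rewrite /G ts mulr1.
exact: multi_pmf_sum1 (simplex_posterior t).2.
Qed.

Lemma outcome_law_sum1 (s : S) : \sum_c outcome_law mu pi k c = 1.
Proof.
transitivity (multi_exp k.-1 (joint mu pi)
    (fun=> multi_exp 1 (posterior mu pi s) (fun=> 1))).
  rewrite -(expect_outcome_law s (fun _ _ => 1)).
  by apply: eq_bigr => c _; rewrite mulr1.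
by rewrite !multi_exp_cst // ?simplex_joint.2 ?(simplex_posterior s).2.
Qed.

(** On the support the initial sample makes the total count positive. Off the support it may be 0;
    the estimate is then the zero vector, about which [receiver_action] says nothing. *)
Lemma simplex_estimate (c : outcome Omega S k) s :
  outcome_law mu pi k c != 0 -> simplex (estimate (R := R) c s).
Proof.
rewrite ffunE mulf_eq0 negb_or => /andP[_ /prodf_neq0 /(_ s isT)].
rewrite multi_pmfE; case: ifP => [/eqP s1 _|_]; last by rewrite eqxx.
set N := (\sum_w' sample_count c w' s)%N.
have N_neq0 : N%:R != 0 :> R.
  by rewrite pnatr_eq0 /N big_split /= s1 addn1.
split=> [w|]; first by rewrite ffunE divr_ge0.
under eq_bigr do rewrite ffunE.
by rewrite -mulr_suml -natr_sum divff.
Qed.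

Lemma estimate_mse s : (1 <= k)%N ->
  expect (outcome_law mu pi k)
    (fun c => dist2 (estimate c s) (posterior mu pi s) ^+ 2) <=
  stochasticity (posterior mu pi s) ^+ 2 / (k%:R * marg mu pi s).
Proof.
move=> k_gt0; rewrite -[X in X%:R * _](prednK k_gt0).
apply: le_trans (multi_exp_mse _ _ _ _ (fun w => joint_posterior w s)
  simplex_joint.2 (simplex_posterior s).2 k.-1 simplex_joint.1 (marg_gt0 s)
  (fun w => simplex_le1 _ w (simplex_posterior s))).
rewrite -(expect_outcome_law s (fun z v => \sum_w
  ((z (w, s) + v w)%:R / (\sum_w' (z (w', s) + v w'))%N%:R -
   posterior mu pi s w) ^+ 2)).
apply: ler_sum => c _; rewrite sqr_sqrtr ?sumr_ge0 // => [|w _]; last exact: sqr_ge0.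
rewrite le_eqVlt; apply/orP; left; apply/eqP; congr (_ * _).
apply: eq_bigr => w _; rewrite [estimate _ _ _]ffunE !ffunE.
by under [in RHS]eq_bigr do rewrite !ffunE.
Qed.

End Outcome.

(** * From the loss at round [k] to the error probabilities, and their bound *)

Section Rounds.
Context {R : realType} {Omega A S : finType}.
Variables (uS uR : Omega -> A -> R) (mu : {ffun Omega -> R}).
Variables (pi : Omega -> {ffun S -> R}) (act : {ffun Omega -> R} -> A) (k : nat).
Hypothesis mu_dist : simplex mu.
Hypothesis pi_dist : forall w, simplex (pi w).
Hypothesis marg_gt0 : forall s, 0 < marg mu pi s.
Hypothesis act_receiver : receiver_action uS uR act.
Hypothesis uS_range : forall w a, 0 <= uS w a <= 1.
Hypothesis k_ge1 : (1 <= k)%N.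

Definition error_prob s : R :=
  expect (outcome_law mu pi k)
    (fun c => (act (estimate c s) != act (posterior mu pi s))%:R).

Lemma error_prob_bounds s : 0 <= error_prob s <= 1.
Proof.
apply/andP; split.
  by apply: sumr_ge0 => c _; rewrite mulr_ge0 ?ler0n ?outcome_law_ge0.
rewrite -(outcome_law_sum1 mu pi mu_dist pi_dist marg_gt0 k s); apply: ler_sum => c _.
by rewrite ler_piMr ?outcome_law_ge0 // lern1 leq_b1.
Qed.

Lemma regret_le_error_prob :
  BPR uS mu pi act - IR uS mu pi act k <= \sum_s marg mu pi s * error_prob s.
Proof.
rewrite /BPR /IR /expect.
under eq_bigr do rewrite mulr_sumr.
under [X in _ - X]eq_bigr do rewrite mulr_sumr.
rewrite exchange_big [X in _ - X]exchange_big -sumrB; apply: ler_sum => s _ /=.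
rewrite -sumrB mulr_suml; apply: ler_sum => w _.
rewrite [joint _ _ _]ffunE /= !mulrA -mulrBr.
apply: ler_wpM2l; first by rewrite mulr_ge0 ?mu_dist.1 ?(pi_dist w).1.
(* The known-commitment utility is averaged over the outcomes too. The comparison is then pointwise:
   utilities in [0,1] differ by at most 1, and not at all when the actions agree. *)
rewrite -[X in X - _]mul1r -(outcome_law_sum1 mu pi mu_dist pi_dist marg_gt0 k s).
rewrite mulr_suml -sumrB; apply: ler_sum => c _; rewrite -mulrBr.
apply: ler_wpM2l; first exact: outcome_law_ge0.
have /andP[u0 _] := uS_range w (act (estimate c s)).
have /andP[_ u1] := uS_range w (act (posterior mu pi s)).
by have [->|_] := eqVneq (act (estimate c s)); rewrite ?subrr //=; lra.
Qed.

Lemma error_prob_le_bound s :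
  ((marg mu pi s * error_prob s)%:E <=
   (Num.sqrt (marg mu pi s / k%:R))%:E *
     nu_over_d (stochasticity (posterior mu pi s))
       (boundary_dist uR act (posterior mu pi s)))%E.
Proof.
set m := marg mu pi s; set y := posterior mu pi s; set d := boundary_dist uR act y.
have m_gt0 : 0 < m by exact: marg_gt0.
have k_gt0 : 0 < k%:R :> R by rewrite ltr0n.
have d_le (c : outcome Omega S k) : outcome_law mu pi k c != 0 ->
    act (estimate c s) != act y -> (d <= (dist2 (estimate c s) y)%:E)%E.
  move=> c_neq0; apply: (boundary_dist_le _ _ _ act_receiver).
    exact: simplex_posterior.
  exact: simplex_estimate c_neq0.
have d_ge0 : (0 <= d)%E := boundary_dist_ge0 _ _ _.
rewrite /nu_over_d; have [_|d_neq0] := eqVneq d 0%E.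
  by rewrite gt0_muley ?leey // lte_fin sqrtr_gt0 divr_gt0.
(* An error at an outcome of nonzero weight would bound [d] by a finite distance, so here the error
   probability is 0. *)
have [d_oo|d_fin] := eqVneq d +oo%E.
  rewrite mule0 lee_fin /error_prob /expect big1 ?mulr0 // => c _.
  have [->|c_neq0] := eqVneq (outcome_law mu pi k c) 0; first by rewrite mul0r.
  have [_|ne] := eqVneq (act (estimate c s)) (act y); first by rewrite mulr0.
  by have := d_le c c_neq0 ne; rewrite d_oo leye_eq.
case: d d_le d_ge0 d_neq0 d_fin => [d||] // d_le d_ge0 d_neq0 _ /=.
have d_gt0 : 0 < d.
  by rewrite lt_neqAle -lee_fin d_ge0 andbT eq_sym; apply: contraNneq d_neq0 => ->.
rewrite -EFinM lee_fin.
have /andP[P0 P1] := error_prob_bounds s.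
have nu_ge0 : 0 <= stochasticity y by exact: sqrtr_ge0.
have markov : error_prob s <= stochasticity y ^+ 2 / (k%:R * m) / d ^+ 2.
  rewrite ler_pdivlMr ?exprn_gt0 //.
  apply: le_trans (estimate_mse mu pi mu_dist pi_dist marg_gt0 k s k_ge1).
  rewrite /error_prob /expect mulr_suml; apply: ler_sum => c _; rewrite -mulrA.
  have [->|c_neq0] := eqVneq (outcome_law mu pi k c) 0; first by rewrite !mul0r.
  apply: ler_wpM2l; first exact: outcome_law_ge0.
  have [_|ne] := eqVneq (act (estimate c s)) (act y); first by rewrite mul0r sqr_ge0.
  rewrite mul1r ler_sqr ?nnegrE ?sqrtr_ge0 ?(ltW d_gt0) // -lee_fin.
  exact: d_le.
(* A probability bounded by r ^ 2 is bounded by r: it is at most 1. *)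
rewrite -ler_sqr ?nnegrE ?mulr_ge0 ?sqrtr_ge0 ?invr_ge0 ?(ltW d_gt0) ?(ltW m_gt0) //.
rewrite exprMn [leRHS]exprMn sqr_sqrtr ?divr_ge0 ?(ltW m_gt0) //.
(* The factor [m ^+ 2] also appears on the left; what remains is the Chebyshev bound. *)
have -> : m / k%:R * (stochasticity y / d) ^+ 2 =
    m ^+ 2 * (stochasticity y ^+ 2 / (k%:R * m) / d ^+ 2).
  by field; rewrite !gt_eqF.
apply: ler_wpM2l; first exact: sqr_ge0.
apply: le_trans markov.
by rewrite expr2 ler_piMr.
Qed.

End Rounds.

Theorem proposition1 (R : realType) (Omega A S : finType)
    (uS uR : Omega -> A -> R) (mu : {ffun Omega -> R})
    (pi : Omega -> {ffun S -> R}) (act : {ffun Omega -> R} -> A) (k : nat)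
    (mu_dist : simplex mu)
    (pi_dist : forall w, simplex (pi w))
    (marg_gt0 : forall s, 0 < marg mu pi s)
    (act_receiver : receiver_action uS uR act)
    (uS_range : forall w a, 0 <= uS w a <= 1)
    (k_ge1 : (1 <= k)%N) :
  ((BPR uS mu pi act - IR uS mu pi act k)%R%:E <=
   \sum_(s : S) (Num.sqrt (marg mu pi s / k%:R))%R%:E *
     nu_over_d (stochasticity (posterior mu pi s))
           (boundary_dist uR act (posterior mu pi s)))%E.
Proof.
apply: (@le_trans _ _ (\sum_s (marg mu pi s * error_prob mu pi act k s)%:E)%E).
  by rewrite sumEFin lee_fin; apply: regret_le_error_prob.
by apply: lee_sum => s _; apply: error_prob_le_bound act_receiver k_ge1 s.
Qed.
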